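(* Let $\nu,\mu_0\in\mathcal P_2(\mathbb R)$, and let $R_\nu^{\pm}$ denote either one of the two functions $R_\nu^+$, $R_\nu^-$. For any fixed continuity point $s\in(0,1)$ of $Q_\nu$, the curve $$g_s(t) := \begin{cases} \Phi_{\nu,s}^{-1}(2t), & t<T_s,\\ Q_\nu(s), & \text{otherwise},\end{cases}$$ where $T_s := \frac12 \Phi_{\nu,s}(Q_\nu(s))$ and $$\Phi_{\nu,s}(x) := \int_{Q_{\mu_0}(s)}^{x} \big(s-R_\nu^{\pm}(z)\big)^{-1}\,dz,\qquad x\in[\min\{Q_{\mu_0}(s),Q_\nu(s)\},\max\{Q_{\mu_0}(s),Q_\nu(s)\}],$$ is a strong solution of the pointwise Cauchy problem $$\partial_t g_s(t) \in 2s-2\,[R_\nu^-(g_s(t)),R_\nu^+(g_s(t))]\ \text{ for a.e. } t>0,\qquad g_s(0)=Q_{\mu_0}(s).$$ In particular, the inclusion holds true for every $t\in(0,\infty)$ at which $\dot g_s(t)$ exists.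
   Context: $\mathcal P_2(\mathbb R)$ is the set of Borel probability measures on $\mathbb R$ with finite second moment. For a probability measure $\mu$ on $\mathbb R$: $R_\mu^+(x) := \mu((-\infty,x])$, $R_\mu^-(x) := \mu((-\infty,x))$ and $Q_\mu(s) := \min\{x \in \mathbb R : R_\mu^+(x) \ge s\}$, $s\in(0,1)$. The values $\Phi_{\nu,s}(Q_\nu(s))$ and $T_s$ may be $+\infty$. A strong solution of the scalar problem is a function $g_s\colon[0,\infty)\to\mathbb R$ that is continuous on $[0,\infty)$ and in $W^1_1((0,T];\mathbb{R})$ (i.e. absolutely continuous) for every $T>0$, satisfies the initial condition, and satisfies the inclusion for a.e. $t>0$. *)

(* Defs.v *)
From HB Require Import structures.
From mathcomp Require Import all_boot all_order all_algebra.
From mathcomp Require Import all_classical all_reals all_analysis.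
Set Implicit Arguments.
Unset Strict Implicit.
Unset Printing Implicit Defensive.
Import Order.TTheory GRing.Theory Num.Theory.
Import numFieldNormedType.Exports.
Local Open Scope classical_set_scope.
Local Open Scope ring_scope.

Section measures_on_the_line.
Context {R : realType}.
Implicit Types (mu : probability (measurableTypeR R) R) (s x : R).

Definition finite_second_moment mu : Prop :=
  (\int[mu]_x ((x : R) ^+ 2)%:E < +oo)%E.

Definition Rplus mu x : R := fine (mu `]-oo, x]%classic).

Definition Rminus mu x : R := fine (mu `]-oo, x[%classic).

(* The default value 0 is only taken for s outside ]0, 1[; see quantile_min. *)
Definition quantile mu s : R :=
  let A := [set x | s <= Rplus mu x] in xget 0 (A `&` lbound A).

Let idR : measurableTypeR R -> R := idfun.

#[local] HB.instance Definition _ :=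
  @isMeasurableFun.Build _ _ _ _ idR (@measurable_id _ _ setT).

Let RplusE mu x : (Rplus mu x)%:E = cdf (idR : {RV mu >-> R}) x.
Proof. by rewrite /Rplus fineK// fin_num_measure. Qed.

Lemma quantile_min mu s : 0 < s < 1 ->
  s <= Rplus mu (quantile mu s) /\
  (forall x, s <= Rplus mu x -> quantile mu s <= x).
Proof.
move=> /andP[s0 s1]; set A := [set x | s <= Rplus mu x].
suff [x Ax] : A `&` lbound A !=set0.
  by have [] := xgetPex 0 (ex_intro _ x Ax).
have Rnd x y : x <= y -> Rplus mu x <= Rplus mu y.
  by move=> xy; rewrite -lee_fin !RplusE; exact: cdf_nondecreasing.
have A0 : A !=set0.
  have := @cvg_cdfy1 _ _ _ mu (idR : {RV mu >-> R}).
  move=> /(_ _ (open_nbhs_nbhs (conj (@open_ereal_gt_ereal _ s%:E) _))).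
  rewrite /= lte_fin => /(_ s1) [M [_ MA]].
  exists (M + 1); rewrite /A/= ltW// -lte_fin RplusE.
  by apply: MA; rewrite ltrDl.
have lbA : has_lbound A.
  have := @cvg_cdfNy0 _ _ _ mu (idR : {RV mu >-> R}).
  move=> /(_ _ (open_nbhs_nbhs (conj (@open_ereal_lt_ereal _ s%:E) _))).
  rewrite /= lte_fin => /(_ s0) [M [_ MA]].
  exists (M - 1) => x; rewrite /A/= => sx.
  rewrite leNgt; apply/negP => xM.
  have /MA /= : x < M by rewrite (lt_trans xM)// gtrBl.
  by rewrite -RplusE lte_fin ltNge sx.
have iA : has_inf A by [].
exists (inf A); split; last by move=> x Ax; exact: ge_inf.
rewrite /A/= leNgt; apply/negP => Rs.
have := @cdf_right_continuous _ _ _ mu (idR : {RV mu >-> R}) (inf A).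
rewrite -RplusE.
move=> /(_ _ (open_nbhs_nbhs (conj (@open_ereal_lt_ereal _ s%:E) _))).
rewrite /= lte_fin => /(_ Rs) [e /= e0 eA].
have [y Ay yA] := inf_adherent e0 iA.
have iy : inf A <= y by exact: ge_inf.
move: iy; rewrite le_eqVlt => /predU1P[iy|iy].
  by move: Ay; rewrite /A/= -iy leNgt Rs.
have /eA /(_ iy) /= : ball (inf A) e y.
  by rewrite /ball/= distrC ger0_norm ?subr_ge0 ?(ltW iy)// ltrBlDl.
by rewrite -RplusE lte_fin ltNge; move: Ay; rewrite /A/= => ->.
Qed.

End measures_on_the_line.

Section cauchy_problem.
Context {R : realType}.
Implicit Types (g : R -> R) (A : set R).

Definition abs_continuous A g : Prop :=
  forall e : R, 0 < e -> exists2 d : R, 0 < d &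
    forall (n : nat) (a b : 'I_n -> R),
      (forall i, a i <= b i /\ `[a i, b i] `<=` A) ->
      trivIset setT (fun i => `]a i, b i[%classic) ->
      \sum_(i < n) (b i - a i) < d ->
      \sum_(i < n) `|g (b i) - g (a i)| < e.

(* Only the values of g on [0, +oo[ matter.  On the bounded intervals ]0, T],
   uniform (epsilon-delta) absolute continuity amounts to membership of
   W^{1,1}: g is bounded and its derivative is integrable there. *)
Definition strong_solution (F : R -> set R) (x0 : R) g : Prop :=
  [/\ {within `[0, +oo[%classic, continuous g},
      forall T : R, 0 < T -> abs_continuous `]0, T] g,
      g 0 = x0 &
      {ae lebesgue_measure,
        forall t : R, 0 < t -> derivable g t 1 /\ F (g t) (derive1 g t)}].

End cauchy_problem.

Section solution_curve.
Context {R : realType}.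
Implicit Types (nu mu : probability (measurableTypeR R) R) (s x t : R).

Definition rhs nu s x : set R :=
  [set 2 * s - 2 * r | r in `[Rminus nu x, Rplus nu x]].

(* f is meant to have a constant sign between a and b, so that the (possibly
   infinite) integral makes sense. *)
Definition oriented_integral (a b : R) (f : R -> R) : \bar R :=
  (if (a <= b)%R then \int[lebesgue_measure]_(z in `[a, b]) (f z)%:E
   else - \int[lebesgue_measure]_(z in `[b, a]) (f z)%:E)%E.

(* Rpm stands for either of Rplus nu, Rminus nu. The integrand can only vanish
   in the denominator at z = quantile nu s, where 0^-1 = 0 is harmless. *)
Definition Phi mu (Rpm : R -> R) s x : \bar R :=
  oriented_integral (quantile mu s) x (fun z => (s - Rpm z)^-1).

Definition Phi_dom nu mu s : set R :=
  `[Num.min (quantile mu s) (quantile nu s),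
    Num.max (quantile mu s) (quantile nu s)].

Definition stop_time nu mu (Rpm : R -> R) s : \bar R :=
  (2^-1%:E * Phi mu Rpm s (quantile nu s))%E.

(* The default value of the inverse is only used outside the range of Phi. *)
Definition solution_curve nu mu (Rpm : R -> R) s t : R :=
  if (t%:E < stop_time nu mu Rpm s)%E
  then 'pinv_(fun=> quantile nu s) (Phi_dom nu mu s) (Phi mu Rpm s) (2 * t)%:E
  else quantile nu s.

End solution_curve.

(* Main.v *)
Require Import Defs.
From mathcomp Require Import all_boot all_order all_algebra.
From mathcomp Require Import all_classical all_reals all_analysis.
From mathcomp Require Import measurable_realfun lra.
Set Implicit Arguments.
Unset Strict Implicit.
Unset Printing Implicit Defensive.
Import Order.TTheory GRing.Theory Num.Theory.
Import numFieldNormedType.Exports.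
Local Open Scope classical_set_scope.
Local Open Scope ring_scope.

(** Write q for the s-quantile of nu, a for that of mu0, and F for the chosen
    distribution function. Strictly between a and q the velocity s - F has a
    constant sign: it is positive to the left of q because q is a minimum, and
    negative to the right of q because the quantile function is continuous at s
    (a jump of it is exactly an interval on which F equals s). Hence Phi is the
    time [arrival] that a particle of velocity s - F needs to go from a to x,
    and the curve is that particle run at double speed and stopped at q.

    F is monotone, so on a stretch run through in time d the velocity lies
    between its values at the two ends; this bounds the displacement
    ([travel_left], [travel_right]). Replacing F by Rminus and Rplus and adding
    the rest at q yields the two facts on which everything else depends. First,
    every difference quotient of g on [t1, t2] lies between 2 (s - Rplus y) and
    2 (s - Rminus x), with x and y the smaller and the larger of g t1 and g t2
    ([curve_slope_bounds]); this form is insensitive to whether a lies to the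
    left or to the right of q. Secondly, g takes a value twice only if it has
    come to rest ([curve_stops]).

    The slope bounds make g 2-Lipschitz, hence continuous and absolutely
    continuous. As Rminus is lower and Rplus upper semicontinuous, they pass to
    the limit t2 -> t1: a derivative of g satisfies the inclusion wherever it
    exists, and it does exist at every t such that g t is not an atom of nu.
    Finally, the exceptional times form a countable set: g is locally constant
    at a time after a repeated value, so each atom is the value of at most one
    of them, and the jumps of the distribution function at distinct atoms
    contain distinct rationals ([countable_nonderivable]). *)

(** * Distribution functions and quantiles *)

Section distribution_functions.
Context {R : realType}.
Implicit Types (nu : probability (measurableTypeR R) R) (s x y e : R).

Let le_prob nu (A B : set R) : measurable A -> measurable B -> A `<=` B ->
  fine (nu A) <= fine (nu B).
Proof.
move=> mA mB AB; apply: fine_le; rewrite ?fin_num_measure//.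
by apply: le_measure => //; rewrite inE.
Qed.

Lemma Rplus_nd nu : {homo Rplus nu : x y / x <= y}.
Proof.
move=> x y xy; apply: le_prob => // z/=; rewrite !in_itv/= => zx.
exact: le_trans xy.
Qed.

Lemma Rminus_nd nu : {homo Rminus nu : x y / x <= y}.
Proof.
move=> x y xy; apply: le_prob => // z/=; rewrite !in_itv/= => zx.
exact: lt_le_trans xy.
Qed.

Lemma Rminus_le_Rplus nu x : Rminus nu x <= Rplus nu x.
Proof. by apply: le_prob => // z/=; rewrite !in_itv/= => /ltW. Qed.

Lemma Rplus_le_Rminus nu x y : x < y -> Rplus nu x <= Rminus nu y.
Proof.
move=> xy; apply: le_prob => // z/=; rewrite !in_itv/= => zx.
exact: le_lt_trans xy.
Qed.

Lemma Rminus_ge0 nu x : 0 <= Rminus nu x.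
Proof. by rewrite /Rminus fine_ge0. Qed.

Lemma Rplus_le1 nu x : Rplus nu x <= 1.
Proof.
by rewrite -lee_fin /Rplus fineK ?fin_num_measure//; exact: probability_le1.
Qed.

Let gap_inv x y : x < y -> exists n, n.+1%:R^-1 < y - x.
Proof.
move=> xy; exists (Num.truncn (y - x)^-1) => //=.
rewrite -[ltRHS]invrK ltf_pV2 ?posrE ?ltr0n// ?invr_gt0 ?subr_gt0//.
exact: truncnS_gt.
Qed.

(** Continuity of nu from below along the rays ]-oo, x - 1/(n+1)]; the bound
    then holds for all y > x - 1/(n+1) by monotonicity. *)
Lemma Rminus_lsc nu x e : 0 < e ->
  \forall y \near x, Rminus nu x - e < Rminus nu y.
Proof.
move=> e0.
have : (nu \o (fun n => `]-oo, x - n.+1%:R^-1]%classic)) @ \oo -->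
    nu `]-oo, x[%classic.
  have -> : `]-oo, x[%classic = \bigcup_n `]-oo, x - n.+1%:R^-1]%classic.
    apply/seteqP; split=> [y|y [n _]]; rewrite /= !in_itv/=.
      move=> /gap_inv[n nxy]; exists n => //=.
      by rewrite in_itv/= lerBrDr addrC -lerBrDr ltW.
    by move=> /le_lt_trans; apply; rewrite ltrBlDr ltrDl.
  apply: nondecreasing_cvg_mu => //; first exact: bigcup_measurable.
  move=> m n mn; apply/subsetPset => y; rewrite /= !in_itv/=.
  move=> /le_trans; apply.
  by rewrite lerD2l lerN2 lef_pV2 ?posrE// ler_nat.
move=> /(_ _ (open_nbhs_nbhs
  (conj (@open_ereal_gt_ereal _ (Rminus nu x - e)%:E) _))).
have nuE : nu `]-oo, x[%classic = (Rminus nu x)%:E.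
  by rewrite fineK ?fin_num_measure.
rewrite /= nuE lte_fin gtrBl => /(_ e0) [n _ /(_ n (leqnn n))/=].
have -> : nu `]-oo, x - n.+1%:R^-1]%classic = (Rplus nu (x - n.+1%:R^-1))%:E.
  by rewrite fineK ?fin_num_measure.
rewrite lte_fin => xn.
near=> y; apply: (lt_le_trans xn); apply: Rplus_le_Rminus.
by near: y; apply: lt_nbhsr; rewrite ltrBlDr ltrDl.
Unshelve. all: by end_near. Qed.

(** The mirror image of [Rminus_lsc], by continuity of nu from above. *)
Lemma Rplus_usc nu x e : 0 < e ->
  \forall y \near x, Rplus nu y < Rplus nu x + e.
Proof.
move=> e0.
have : (nu \o (fun n => `]-oo, x + n.+1%:R^-1]%classic)) @ \oo -->
    nu `]-oo, x]%classic.
  have -> : `]-oo, x]%classic = \bigcap_n `]-oo, x + n.+1%:R^-1]%classic.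
    apply/seteqP; split=> [y + n _|y yI]; rewrite /= !in_itv/=.
      by move=> /le_trans; apply; rewrite lerDl.
    rewrite leNgt; apply/negP => /gap_inv[n nxy].
    by have := yI n Logic.I; rewrite /= in_itv/= leNgt -ltrBrDl nxy.
  apply: nonincreasing_cvg_mu => //.
  - by rewrite -ge0_fin_numE// fin_num_measure.
  - exact: bigcap_measurable.
  move=> m n mn; apply/subsetPset => y; rewrite /= !in_itv/=.
  move=> /le_trans; apply.
  by rewrite lerD2l lef_pV2 ?posrE// ler_nat.
move=> /(_ _ (open_nbhs_nbhs
  (conj (@open_ereal_lt_ereal _ (Rplus nu x + e)%:E) _))).
have nuE y : nu `]-oo, y]%classic = (Rplus nu y)%:E.
  by rewrite fineK ?fin_num_measure.
rewrite /= nuE lte_fin ltrDl => /(_ e0) [n _ /(_ n (leqnn n))/=].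
rewrite nuE lte_fin => xn.
near=> y; apply: le_lt_trans xn; apply/Rplus_nd/ltW.
by near: y; apply: lt_nbhsl; rewrite ltrDl.
Unshelve. all: by end_near. Qed.

Lemma Rplus_lt_quantile nu s x : 0 < s < 1 -> x < quantile nu s ->
  Rplus nu x < s.
Proof.
move=> s01 xq; rewrite ltNge; apply/negP => /((quantile_min nu s01).2 x).
by rewrite leNgt xq.
Qed.

Lemma Rminus_quantile nu s : 0 < s < 1 -> Rminus nu (quantile nu s) <= s.
Proof.
move=> s01; apply/ler_addgt0Pr => e e0; rewrite -lerBlDr.
have [d /= d0 qd] := Rminus_lsc nu (quantile nu s) e0.
have q2 : quantile nu s - d / 2 < quantile nu s by rewrite gtrBl divr_gt0.
have /qd/ltW/le_trans : ball (quantile nu s) d (quantile nu s - d / 2).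
  by rewrite /ball/= opprB addrC subrK ger0_norm ?divr_ge0 ?ltW//; lra.
apply; apply: (le_trans (Rminus_le_Rplus _ _)).
exact/ltW/Rplus_lt_quantile.
Qed.

(** If the mass of ]-oo, x[ did not exceed s, then for every r > s the
    r-quantile would be at least x, and the quantile function would jump over
    the interval from its value at s to x. *)
Lemma Rminus_gt_quantile nu s x : 0 < s < 1 ->
  {for s, continuous (quantile nu)} -> quantile nu s < x -> s < Rminus nu x.
Proof.
move=> /andP[s0 s1] sc qx; rewrite ltNge; apply/negP => xs.
have [d /= d0 sd] := sc _ (lt_nbhsl qx).
pose r := Num.min (s + d / 2) ((s + 1) / 2).
have sr : s < r by rewrite lt_min; apply/andP; split; lra.
have r1 : r < 1 by rewrite gt_min; apply/orP; right; lra.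
have rd : r <= s + d / 2 by rewrite ge_min lexx.
have /sd : ball s d r by rewrite /ball/= distrC gtr0_norm ?subr_gt0//; lra.
move=> /Rplus_le_Rminus - /(_ nu) rx.
have r01 : 0 < r < 1 by rewrite r1 (lt_trans s0).
have := (quantile_min nu r01).1; lra.
Qed.

End distribution_functions.

(** * From bounds on difference quotients to strong solutions *)

Section difference_quotients.
Context {R : realType}.
Variables (nu : probability (measurableTypeR R) R) (s : R) (g : R -> R).

(** The velocity decreases with the position, so that the larger position bounds
    the quotient from below, whichever way the curve moves. *)
Definition slope_bounds : Prop := forall t1 t2 : R, 0 <= t1 -> t1 < t2 ->
  2 * (t2 - t1) * (s - Rplus nu (Num.max (g t1) (g t2))) <= g t2 - g t1 <=
  2 * (t2 - t1) * (s - Rminus nu (Num.min (g t1) (g t2))).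

Definition stops_when_repeating : Prop := forall t1 t2 t : R,
  0 <= t1 -> t1 < t2 -> g t1 = g t2 -> t1 <= t -> g t = g t1.

Hypotheses (s01 : 0 < s < 1) (gP : slope_bounds) (gM : stops_when_repeating).

Let lipschitz (t1 t2 : R) : 0 <= t1 -> 0 <= t2 ->
  `|g t1 - g t2| <= 2 * `|t1 - t2|.
Proof.
wlog t12 : t1 t2 / t1 <= t2 => [wl t10 t20|t10 _].
  have [t12|/ltW t21] := leP t1 t2; first exact: wl.
  by rewrite distrC [in leRHS]distrC wl.
move: t12; rewrite le_eqVlt => /predU1P[->|t12].
  by rewrite !subrr normr0 mulr0.
have /andP[l u] := gP t10 t12.
have a0 := Rminus_ge0 nu (Num.min (g t1) (g t2)).
have b1 := Rplus_le1 nu (Num.max (g t1) (g t2)).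
have d0 : 0 < t2 - t1 by rewrite subr_gt0.
rewrite distrC [in leRHS]distrC (gtr0_norm d0) ler_norml.
case/andP: s01 => ? ?.
by apply/andP; split; nra.
Qed.

(* Freezing g at its initial value for negative times gives a function that is
   continuous on the whole line. *)
Let continuous_max0 : continuous (fun t : R => g (Num.max 0 t)).
Proof.
move=> t; apply/cvgrPdist_le => e e0.
near=> u.
apply: le_trans (lipschitz _ _) _; rewrite ?le_max ?lexx//.
have : `|t - u| <= e / 2.
  by near: u; apply: cvgr_dist_le; [exact: cvg_id|rewrite divr_gt0].
have : `|Num.max 0 t - Num.max 0 u| <= `|t - u|.
  case: (lerP 0 t) => t0; case: (lerP 0 u) => u0;
    rewrite ler_norml; have := ler_norm (t - u);
    have := ler_norm (u - t); rewrite (distrC u);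
    move=> ? ?; apply/andP; split; lra.
lra.
Unshelve. all: by end_near. Qed.

Let gE (t : R) : 0 <= t -> g t = g (Num.max 0 t).
Proof. by move=> t0; rewrite max_r. Qed.

Lemma within_continuous_curve : {within `[0, +oo[%classic, continuous g}.
Proof.
apply: (@subspace_eq_continuous _ _ _ (fun t : R => g (Num.max 0 t))).
  by move=> t; rewrite inE/= in_itv/= andbT => /gE.
exact: continuous_subspaceT.
Qed.

Lemma abs_continuous_curve (T : R) : abs_continuous `]0, T] g.
Proof.
move=> e e0; exists (e / 2); first by rewrite divr_gt0.
move=> n a b ab _ sumd.
have : \sum_(i < n) `|g (b i) - g (a i)| <= \sum_(i < n) 2 * (b i - a i).
  apply: ler_sum => i _; have [abi abT] := ab i.
  have a0 : 0 <= a i.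
    have /abT : `[a i, b i]%classic (a i);
      by rewrite /= in_itv/= ?lexx// => /andP[/ltW].
  apply: le_trans (lipschitz _ a0) _; first exact: le_trans abi.
  by rewrite ger0_norm ?subr_ge0.
rewrite -mulr_sumr; lra.
Qed.

(** The values of g near t are close to g t, so semicontinuity of Rminus and
    Rplus replaces both end positions in the slope bounds by g t, up to e. *)
Lemma slope_near (t e : R) : 0 < t -> 0 < e -> \forall h \near 0^',
  2 * (s - Rplus nu (g t)) - e <= h^-1 * (g (h + t) - g t) <=
  2 * (s - Rminus nu (g t)) + e.
Proof.
move=> t0 e0.
have e20 : 0 < e / 2 by rewrite divr_gt0.
have gt : (g (h + t) @[h --> 0]) --> g t.
  apply/cvgrPdist_le => d d0; near=> h.
  have th0 : 0 <= h + t.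
    by rewrite -lerBlDr sub0r ltW//; near: h; apply: lt_nbhsr; rewrite oppr_lt0.
  apply: le_trans (lipschitz (ltW t0) th0) _.
  rewrite opprD addrCA subrr addr0.
  have : `|- h| <= d / 2.
    rewrite -sub0r; near: h.
    by apply: cvgr_dist_le; [exact: cvg_id|rewrite divr_gt0].
  lra.
near=> h.
have h0 : h != 0 by near: h; exact: nbhs_dnbhs_neq.
have th0 : 0 < h + t.
  rewrite -ltrBlDr sub0r; near: h; apply: nbhs_dnbhs.
  by apply: lt_nbhsr; rewrite oppr_lt0.
have mh : Rminus nu (g t) - e / 2 < Rminus nu (Num.min (g t) (g (h + t))).
  rewrite /Num.min; case: ifP => _; first by rewrite gtrBl.
  by near: h; apply: nbhs_dnbhs; exact: (gt _ (Rminus_lsc nu (g t) e20)).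
have ph : Rplus nu (Num.max (g t) (g (h + t))) < Rplus nu (g t) + e / 2.
  rewrite /Num.max; case: ifP => _; last by rewrite ltrDl.
  by near: h; apply: nbhs_dnbhs; exact: (gt _ (Rplus_usc nu (g t) e20)).
have [hlt0|hgt0|h00] := ltgtP h 0; last by rewrite h00 eqxx in h0.
  have hNt : h + t < t by rewrite gtrDr.
  have := gP (ltW th0) hNt.
  rewrite (minC (g _)) (maxC (g _)) opprD addrCA subrr addr0 => /andP[l u].
  rewrite -[h^-1]opprK -invrN mulNr -mulrN opprB.
  have k0 : 0 < - h by rewrite oppr_gt0.
  by rewrite ler_pdivlMl// ler_pdivrMl//; apply/andP; split; nra.
have hNt : t < h + t by rewrite ltrDr.
have := gP (ltW t0) hNt; rewrite addrK => /andP[l u].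
by rewrite ler_pdivlMl// ler_pdivrMl//; apply/andP; split; nra.
Unshelve. all: by end_near. Qed.

Lemma derive_in_rhs (t : R) : 0 < t -> derivable g t 1 ->
  rhs nu s (g t) (derive1 g t).
Proof.
move=> t0 dg; have cvg_slope : cvg ((fun h => h^-1 * (g (h + t) - g t)) @ 0^').
  move: dg; rewrite /derivable; set q := (fun h => _).
  set q' := (fun h => _ * _); suff -> : q = q' by [].
  by apply/funext => h; rewrite /q /q' /= [_%:A]mulr1.
have lo : 2 * (s - Rplus nu (g t)) <= derive1 g t.
  apply/ler_addgt0Pr => e e0; rewrite -lerBlDr.
  apply: limr_ge => //; near=> h.
  suff /andP[] : 2 * (s - Rplus nu (g t)) - e <= h^-1 * (g (h + t) - g t) <=
    2 * (s - Rminus nu (g t)) + e by [].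
  by near: h; exact: slope_near.
have hi : derive1 g t <= 2 * (s - Rminus nu (g t)).
  apply/ler_addgt0Pr => e e0; apply: limr_le => //; near=> h.
  suff /andP[] : 2 * (s - Rplus nu (g t)) - e <= h^-1 * (g (h + t) - g t) <=
    2 * (s - Rminus nu (g t)) + e by [].
  by near: h; exact: slope_near.
exists (s - derive1 g t / 2); last by lra.
by rewrite /= in_itv/=; apply/andP; split; lra.
Unshelve. all: by end_near. Qed.

(** The two bounds of [slope_near] coincide up to 2 e. *)
Lemma derivable_off_atoms (t : R) : 0 < t ->
  Rminus nu (g t) = Rplus nu (g t) -> derivable g t 1.
Proof.
move=> t0 jump0; apply/cvg_ex; exists (2 * (s - Rplus nu (g t))).
apply/cvgrPdist_le => e e0; near=> h.
rewrite /= [_%:A]mulr1 distrC ler_distl.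
suff : 2 * (s - Rplus nu (g t)) - e <= h^-1 * (g (h + t) - g t) <=
  2 * (s - Rminus nu (g t)) + e by rewrite jump0.
by near: h; exact: slope_near.
Unshelve. all: by end_near. Qed.

Lemma derivable_repeated (t1 t2 : R) : 0 <= t1 -> t1 < t2 -> g t1 = g t2 ->
  derivable g t2 1.
Proof.
move=> t10 t12 g12; apply: (@near_eq_derivable _ _ _ (cst (g t1))).
  near=> t; apply/esym/(gM t10 t12 g12)/ltW.
  by near: t; exact: lt_nbhsr.
exact: derivable_cst.
Unshelve. all: by end_near. Qed.

(** Sending a time t of non-derivability to a rational between Rminus (g t) and
    Rplus (g t) is injective: equal rationals force equal positions, since the
    jumps of a monotone function are disjoint, and a position occupied twice is
    occupied forever, which makes g derivable at the later time. *)
Lemma countable_nonderivable : countable [set t | 0 < t /\ ~ derivable g t 1].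
Proof.
set N := (X in countable X).
have jump t : N t -> exists r : rat,
    Rminus nu (g t) < ratr r < Rplus nu (g t).
  move=> [t0 ndg].
  have : Rminus nu (g t) < Rplus nu (g t).
    rewrite lt_neqAle Rminus_le_Rplus andbT; apply/eqP.
    by move/(derivable_off_atoms t0).
  by move=> /rat_in_itvoo[r]; rewrite in_itv/=; exists r.
have [f fP] : exists f : R -> rat, forall t, N t ->
    Rminus nu (g t) < ratr (f t) < Rplus nu (g t).
  exists (fun t =>
    if pselect (N t) is left Nt then projT1 (cid (jump t Nt)) else 0).
  by move=> t Nt; case: pselect => // Nt'; case: cid.
have /countable_injP[p p_inj] : countable [set: rat] by exact: countableP.
apply/countable_injP; exists (p \o f) => t1 t2 /set_mem N1 /set_mem N2.
move=> /p_inj f12E; have {}f12E : f t1 = f t2 by apply: f12E; exact: in_setT.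
have g12 : g t1 = g t2.
  move: (fP _ N1) (fP _ N2); rewrite -f12E.
  move: (ratr (f t1)) => r /andP[l1 u1] /andP[l2 u2].
  case: (ltgtP (g t1) (g t2)) => // /(Rplus_le_Rminus nu) le12.
    by have := lt_trans (lt_le_trans u1 le12) l2; rewrite ltxx.
  by have := lt_trans (lt_le_trans u2 le12) l1; rewrite ltxx.
have [t12|t21|//] := ltgtP t1 t2.
  by case: N2 => _ []; apply: derivable_repeated g12 => //; apply/ltW/N1.1.
by case: N1 => _ []; apply: derivable_repeated (esym g12) => //; apply/ltW/N2.1.
Qed.

Lemma strong_solution_of_slope_bounds x0 : g 0 = x0 ->
  strong_solution (rhs nu s) x0 g.
Proof.
move=> g0; split => //.
- exact: within_continuous_curve.
- by move=> T _; exact: abs_continuous_curve.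
exists [set t | 0 < t /\ ~ derivable g t 1]; split.
- apply: countable_measurable countable_nonderivable => t.
  exact: measurable_set1.
- exact: countable_lebesgue_measure0 countable_nonderivable.
move=> t /= notP; apply: contrapT => nN; apply: notP => t0.
have dg : derivable g t 1 by apply: contrapT => ?; apply: nN.
by split => //; exact: derive_in_rhs.
Qed.

End difference_quotients.

(** * Travel times along a monotone velocity field *)

Section travel_time.
Context {R : realType}.
Local Notation mu := (@lebesgue_measure R).
Implicit Types (x y z c d W : R) (D : set R).
Variables (F : R -> R) (s : R).
Hypothesis F_nd : {homo F : x y / x <= y}.

Let w z := s - F z.
Let h z := `|w z|^-1.

(** The absolute value makes the integrand nonnegative on the whole line, so that
    travel times to the left and to the right of the target obey the same
    rules. A zero of s - F contributes 0^-1 = 0, which is wrong only if the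
    zeros have positive measure. *)
Definition travel (x y : R) : \bar R :=
  (\int[mu]_(z in `[x, y]) (`|s - F z|^-1)%:E)%E.

Let w_ni x y : x <= y -> w y <= w x.
Proof. by move=> xy; rewrite /w lerD2l lerN2 F_nd. Qed.

Let mw : measurable_fun [set: R] w.
Proof.
by apply: measurable_funB => //; exact: nondecreasing_measurable.
Qed.

Let mh : measurable_fun [set: R] h.
Proof.
(* 0 to the power -1 is 0, in accordance with 0^-1 = 0. *)
have -> : h = (@powR R ^~ (-1)) \o (Num.norm \o w).
  by apply/funext => z /=; rewrite powR_inv1.
apply: measurableT_comp; first exact: measurable_powR.
exact: measurableT_comp mw.
Qed.

(** Inversion is not continuous at 0; the identity v^-1 = v |v|^-2, valid also
    at v = 0, reduces the claim to the inverse of the absolute value. *)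
Lemma measurable_inv_speed D : measurable_fun D (fun z => (s - F z)^-1).
Proof.
apply: (@measurable_funS _ _ _ _ setT) => //.
have -> : (fun z => (s - F z)^-1) = w \* (h \* h).
  apply/funext => z /=; rewrite -[s - F z]/(w z) /h.
  rewrite -invfM -normrM ger0_norm; last by rewrite -expr2 sqr_ge0.
  have [->|w0] := eqVneq (w z) 0; first by rewrite invr0 mul0r.
  by rewrite invfM mulrA mulfV// mul1r.
by apply: measurable_funM => //; exact: measurable_funM.
Qed.

Lemma measurable_abs_inv_speed D :
  measurable_fun D (EFin \o fun z => `|s - F z|^-1).
Proof. by apply/measurable_EFinP; exact: measurable_funS mh. Qed.

Let h_ge0 z : (0 <= (h z)%:E)%E.
Proof. by rewrite lee_fin invr_ge0. Qed.

Lemma travel_ge0 x y : (0 <= travel x y)%E.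
Proof. by apply: integral_ge0 => z _; exact: h_ge0. Qed.

Lemma travel_oo x y :
  travel x y = (\int[mu]_(z in `]x, y[) (`|s - F z|^-1)%:E)%E.
Proof.
rewrite /travel (@integral_itv_bndoo _ _ _ _ true false)//.
exact: measurable_abs_inv_speed.
Qed.

Lemma travelxx x : travel x x = 0%E.
Proof. by rewrite travel_oo set_itv_ge ?integral_set0// bnd_simp ltxx. Qed.

Lemma travel_split x y z : x <= y -> y <= z ->
  travel x z = (travel x y + travel y z)%E.
Proof.
move=> xy yz; rewrite {1}/travel.
have -> : `[x, z]%classic = `[x, y] `|` `]y, z].
  by rewrite -itv_bndbnd_setU// bnd_simp.
rewrite ge0_integral_setU//=.
- congr (_ + _)%E; rewrite integral_itv_obnd_cbnd//.
  exact: measurable_abs_inv_speed.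
- exact: measurable_abs_inv_speed.
- apply/disj_setPS => t/= [] /=; rewrite !in_itv/= => /andP[_ ty] /andP[yt _].
  by move: (lt_le_trans yt ty); rewrite ltxx.
Qed.

Lemma travel_subset x y x' y' : x' <= x -> y <= y' ->
  (travel x y <= travel x' y')%E.
Proof.
move=> xx yy; apply: ge0_subset_integral => //.
- exact: measurable_abs_inv_speed.
- by apply: subset_itv; rewrite bnd_simp.
Qed.

Let travel_scale x y W : 0 <= W -> (W%:E * travel x y =
  \int[mu]_(z in `]x, y[) (W * `|s - F z|^-1)%:E)%E.
Proof.
move=> W0; rewrite travel_oo -ge0_integralZl_EFin//.
exact: measurable_abs_inv_speed.
Qed.

Let length_integral (x y : R) : x <= y ->
  ((y - x)%:E = \int[mu]_(z in `]x, y[) (cst 1%E) z)%E.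
Proof.
move=> xy; rewrite integral_cst//= mul1e lebesgue_measure_itv/= lte_fin.
case: ltP => // yx; have -> : x = y by apply/le_anti; rewrite xy.
by rewrite subrr.
Qed.

Let m_scaled D W : measurable_fun D (fun z => (W * `|s - F z|^-1)%:E).
Proof.
apply/measurable_EFinP; apply: measurable_funM => //.
exact: measurable_funS mh.
Qed.

(** Distance is at most maximal speed times duration; the speed has to be nonzero
    because the integrand is 0 instead of +oo at its zeros. *)
Lemma travel_lower x y W d : x <= y -> 0 <= W ->
  (forall z, x < z < y -> 0 < `|s - F z| <= W) ->
  travel x y = d%:E -> y - x <= W * d.
Proof.
move=> xy W0 wW xyd; rewrite -lee_fin EFinM -xyd travel_scale//.
rewrite length_integral//; apply: ge0_le_integral => //=; first exact: m_scaled.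
move=> z; rewrite in_itv/= => /wW/andP[w0 zW].
by rewrite lee_fin ler_pdivlMr// mul1r.
Qed.

Let travel_uppere x y W : x <= y -> 0 <= W ->
  (forall z, x < z < y -> W <= `|s - F z|) ->
  (W%:E * travel x y <= (y - x)%:E)%E.
Proof.
move=> xy W0 wW; rewrite travel_scale// length_integral//.
apply: ge0_le_integral => //=.
- by move=> z _; rewrite lee_fin mulr_ge0.
- exact: m_scaled.
move=> z; rewrite in_itv/= => /wW zW.
have [->|w0] := eqVneq `|s - F z| 0; first by rewrite invr0 mulr0.
by rewrite lee_fin ler_pdivrMr ?mul1r// lt_neqAle eq_sym w0/=.
Qed.

Lemma travel_upper x y W d : x <= y -> 0 <= W ->
  (forall z, x < z < y -> W <= `|s - F z|) ->
  travel x y = d%:E -> W * d <= y - x.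
Proof.
by move=> xy W0 wW xyd; rewrite -lee_fin EFinM -xyd; exact: travel_uppere.
Qed.

Lemma travel_fin x y W : x <= y -> 0 < W ->
  (forall z, x < z < y -> W <= `|s - F z|) -> travel x y \is a fin_num.
Proof.
move=> xy W0 wW; rewrite ge0_fin_numE ?travel_ge0//.
have := travel_uppere xy (ltW W0) wW.
by case: (travel x y) => [r|/=|//]; rewrite ?ltry// gt0_muley ?lte_fin.
Qed.

(** Monotone convergence along the intervals [x + 1/(n+1), y - 1/(n+1)]. This is
    what shows that even an infinite travel time to the target is approached
    by the finite times to points before it. *)
Lemma travel_exhaust x y c : 0 <= c -> (c%:E < travel x y)%E ->
  exists x' y', [/\ x < x', x' <= y', y' < y & (c%:E < travel x' y')%E].
Proof.
move=> c0; rewrite travel_oo.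
pose I n := `[x + n.+1%:R^-1, y - n.+1%:R^-1]%classic.
have -> : `]x, y[%classic = \bigcup_n I n.
  apply/seteqP; split=> [z|z [n _]]; rewrite /I/= !in_itv/=.
    move=> /andP[xz zy].
    have gap (u : R) : 0 < u -> \forall n \near \oo, n.+1%:R^-1 < u.
      by move=> u0; exact: near_infty_natSinv_lt (PosNum u0).
    have : \forall n \near \oo,
      n.+1%:R^-1 < z - x :> R /\ n.+1%:R^-1 < y - z :> R.
      by near=> n; split; near: n; apply: gap; rewrite subr_gt0.
    move=> [n _ /(_ n (leqnn n))] [nx ny]; exists n => //=; rewrite in_itv/=.
    rewrite -lerBrDl ltW//= lerBrDr addrC -lerBrDr ltW//.
  move=> /andP[xz zy]; apply/andP; split.
    by apply: lt_le_trans xz; rewrite ltrDl.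
  by apply: le_lt_trans zy _; rewrite gtrBl.
move=> clt.
have I_nd : nondecreasing_seq I.
  move=> m n mn; apply/subsetPset/subset_itv; rewrite bnd_simp.
    by rewrite lerD2l lef_pV2 ?posrE// ler_nat.
  by rewrite lerD2l lerN2 lef_pV2 ?posrE// ler_nat.
have I_cvg : (\int[mu]_(z in I i) (`|s - F z|^-1)%:E @[i --> \oo] -->
    \int[mu]_(z in \bigcup_i I i) (`|s - F z|^-1)%:E)%E.
  apply: ge0_nondecreasing_set_cvg_integral => //.
  - by move=> n; exact: measurable_itv.
  - by move=> n; exact: measurable_abs_inv_speed.
have := I_cvg _ (open_nbhs_nbhs (conj (@open_ereal_gt_ereal _ c%:E) clt)).
move=> [n _ /(_ n (leqnn n))]/= cn.
exists (x + n.+1%:R^-1), (y - n.+1%:R^-1); split => //.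
- by rewrite ltrDl.
- rewrite leNgt; apply/negP => yx; move: cn.
  by rewrite /I set_itv_ge ?integral_set0 ?bnd_simp -?ltNge// lte_fin ltNge c0.
- by rewrite gtrBl.
Unshelve. all: by end_near. Qed.

Lemma travel_IVT x y c : x <= y -> travel x y \is a fin_num -> 0 <= c ->
  (c%:E <= travel x y)%E ->
  exists z, [/\ x <= z, z <= y & travel x z = c%:E].
Proof.
move=> xy xyfin c0 cxy.
have h_int : mu.-integrable `[x, y] (EFin \o h).
  apply/integrableP; split; first exact: measurable_abs_inv_speed.
  under eq_integral => z _ do rewrite gee0_abs ?h_ge0//.
  by rewrite ltey_eq xyfin.
have travelE z : x <= z -> z <= y ->
    travel x z = (\int[mu]_(t in `[x, z]) h t)%:E.
  move=> xz zy; rewrite fineK//.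
  rewrite ge0_fin_numE ?travel_ge0//.
  rewrite (le_lt_trans (travel_subset (lexx x) zy))//.
  by rewrite -ge0_fin_numE ?travel_ge0.
have [] := @IVT R (fun z => \int[mu]_(t in `[x, z]) h t) x y c xy.
- exact: parameterized_integral_continuous.
- have -> : \int[mu]_(t in `[x, x]) h t = 0.
    by apply: EFin_inj; rewrite -travelE// travelxx.
  have t0 : 0 <= \int[mu]_(t in `[x, y]) h t.
    by rewrite -lee_fin -travelE ?travel_ge0.
  by rewrite min_l// max_r// c0 -lee_fin -travelE.
- by move=> z; rewrite in_itv/= => /andP[xz zy] <-; exists z; rewrite travelE.
Qed.

(** A velocity field pointing towards the target q from both sides. *)
Section near_the_target.
Variable q : R.
Hypotheses (F_lt : forall z, z < q -> F z < s)
  (F_gt : forall z, q < z -> s < F z).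

Let w_gt0 z : z < q -> 0 < s - F z.
Proof. by move=> /F_lt; rewrite subr_gt0. Qed.

Let w_lt0 z : q < z -> s - F z < 0.
Proof. by move=> /F_gt; rewrite subr_lt0. Qed.

Lemma travel_lt_fin x y : x <= y -> y < q \/ q < x -> travel x y \is a fin_num.
Proof.
move=> xy [yq|qx].
  apply: (travel_fin xy (w_gt0 yq)) => z /andP[_ zy].
  by rewrite (le_trans (w_ni (ltW zy)))// ler_norm.
apply: (@travel_fin _ _ (- (s - F x)) xy) => [|z /andP[xz _]].
  by rewrite oppr_gt0 w_lt0.
by rewrite -normrN (le_trans _ (ler_norm _))// lerN2; exact/w_ni/ltW.
Qed.

(** To the left of q the speed decreases, so that it is at most s - F x and at
    least s - F y on [x, y]. At y = q the lower bound may be negative, and then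
    it holds for trivial reasons. *)
Lemma travel_left x y d : x <= y -> y <= q -> travel x y = d%:E ->
  d * (s - F y) <= y - x <= d * (s - F x).
Proof.
rewrite le_eqVlt => /predU1P[<- _|xy yq].
  by rewrite travelxx => -[<-]; rewrite !mul0r subrr lexx.
move=> xyd; have d0 : 0 <= d by rewrite -lee_fin -xyd travel_ge0.
have xq : x < q by exact: lt_le_trans yq.
apply/andP; split; last first.
  rewrite mulrC; apply: travel_lower xyd; rewrite ?ltW ?w_gt0//.
  move=> z /andP[xz zy]; have wz := w_gt0 (lt_le_trans zy yq).
  by rewrite gtr0_norm// wz w_ni// ltW.
have [wy|wy] := leP 0 (s - F y); last by nra.
rewrite mulrC; apply: travel_upper xyd => //; first exact: ltW.
move=> z /andP[xz zy].
by rewrite (le_trans (w_ni (ltW zy)))// ler_norm.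
Qed.

(** The mirror image of [travel_left]: the particle runs from y down to x with
    speed F - s. *)
Lemma travel_right x y d : x <= y -> q <= x -> travel x y = d%:E ->
  d * (s - F y) <= x - y <= d * (s - F x).
Proof.
rewrite le_eqVlt => /predU1P[<- _|xy qx].
  by rewrite travelxx => -[<-]; rewrite !mul0r subrr lexx.
move=> xyd; have d0 : 0 <= d by rewrite -lee_fin -xyd travel_ge0.
have qy : q < y by exact: le_lt_trans xy.
rewrite -lerN2 opprB -mulrN [leRHS]mulrC; apply/andP; split.
  apply: travel_lower xyd; rewrite ?oppr_ge0 ?ltW ?w_lt0//.
  move=> z /andP[xz zy]; have wz := w_lt0 (le_lt_trans qx xz).
  by rewrite ltr0_norm// oppr_gt0 wz lerN2 w_ni// ltW.
have [wx|wx] := leP (s - F x) 0; last by nra.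
rewrite -lerN2 opprB -mulrN mulrC; apply: travel_upper xyd => //.
- exact: ltW.
- by rewrite oppr_ge0.
- move=> z /andP[xz zy].
  by rewrite -normrN (le_trans _ (ler_norm _))// lerN2; exact/w_ni/ltW.
Qed.

Lemma travel_gt0 x y : x < y -> y <= q \/ q <= x -> (0 < travel x y)%E.
Proof.
move=> xy side; rewrite lt_neqAle travel_ge0 andbT; apply/eqP => /esym t0.
have := xy; case: side => [yq|qx].
  by have := travel_left (ltW xy) yq t0; lra.
by have := travel_right (ltW xy) qx t0; lra.
Qed.

Variable a : R.
Let D x := Num.min a q <= x <= Num.max a q.

Definition arrival x : \bar R := travel (Num.min a x) (Num.max a x).

(** The hypothesis 0 <= d says that y is reached after x; the conclusion is the
    same for a <= q and q <= a, since min and max turn the two end velocities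
    into a lower and an upper bound in both cases. For d = 0 it says that the
    arrival time is injective. *)
Lemma arrival_increment x y r d : D x -> D y -> 0 <= d ->
  arrival x = r%:E -> arrival y = (r + d)%:E ->
  d * (s - F (Num.max x y)) <= y - x <= d * (s - F (Num.min x y)).
Proof.
rewrite /D /arrival.
have [aq|/ltW qa] := leP a q => /andP[ax xq] /andP[ay yq] d0.
  rewrite (min_l ax) (max_r ax) (min_l ay) (max_r ay) => xr yr.
  have [xy|yx] := leP x y.
    apply: (travel_left xy yq); have := travel_split ax xy.
    rewrite xr yr; case: (travel x y) => //= u [rd]; congr (_%:E); lra.
  have := travel_gt0 yx (or_introl xq).
  have := travel_split ay (ltW yx).
  rewrite xr yr; case: (travel y x) => //= u [rd]; rewrite lte_fin; lra.
rewrite (min_r xq) (max_l xq) (min_r yq) (max_l yq) => xr yr.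
rewrite minC maxC; have [yx|xy] := leP y x.
  apply: (travel_right yx ay); have := travel_split yx xq.
  rewrite xr yr; case: (travel y x) => //= u [rd]; congr (_%:E); lra.
have := travel_gt0 xy (or_intror ax).
have := travel_split (ltW xy) yq.
rewrite xr yr; case: (travel x y) => //= u [rd]; rewrite lte_fin; lra.
Qed.

(** By [travel_exhaust] some point before q is reached later than c but in finite
    time; up to that point the arrival time is a continuous function. *)
Lemma arrival_surj c : 0 <= c -> (c%:E < arrival q)%E ->
  exists2 x, D x & arrival x = c%:E.
Proof.
move=> c0; rewrite /D /arrival.
have [aq|/ltW qa] := leP a q => /(travel_exhaust c0)[x [y [ax xy yq cxy]]].
  have ay : a <= y by exact: le_trans (ltW ax) xy.
  have cay : (c%:E <= travel a y)%E.
    by apply: le_trans (ltW cxy) _; apply: travel_subset => //; exact: ltW.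
  have [z [az zy zc]] := travel_IVT ay (travel_lt_fin ay (or_introl yq)) c0 cay.
  exists z; first by rewrite az (le_trans zy (ltW yq)).
  by rewrite min_l// max_r.
have xa : x <= a by exact: le_trans xy (ltW yq).
have cxa : (c%:E <= travel x a)%E.
  by apply: le_trans (ltW cxy) _; apply: travel_subset => //; exact: ltW.
(* Here the lower end of the interval moves, so [travel_IVT] is applied to the
   complementary time t - c. *)
have xafin := travel_lt_fin xa (or_intror ax).
have [t tE] : exists t : R, travel x a = t%:E.
  by exists (fine (travel x a)); rewrite fineK.
have tc0 : 0 <= t - c by rewrite subr_ge0 -lee_fin -tE.
have tct : ((t - c)%:E <= travel x a)%E by rewrite tE lee_fin gerBl.
have [z [xz za zc]] := travel_IVT xa xafin tc0 tct.
exists z; first by rewrite za (le_trans (ltW ax) xz).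
rewrite min_r// max_l//; have := travel_split xz za.
by rewrite tE zc; case: (travel z a) => //= u [tu]; congr (_%:E); lra.
Qed.

End near_the_target.
End travel_time.

(** * The solution curve *)

Section the_solution_curve.
Context {R : realType}.
Variables (nu mu0 : probability (measurableTypeR R) R) (Rpm : R -> R) (s : R).
Hypotheses (RpmE : Rpm = Rplus nu \/ Rpm = Rminus nu) (s01 : 0 < s < 1)
  (sc : {for s, continuous (quantile nu)}).

Let q := quantile nu s.
Let a := quantile mu0 s.
Let g := solution_curve nu mu0 Rpm s.

Let Rpm_nd : {homo Rpm : x y / x <= y}.
Proof. by case: RpmE => -> ; [exact: Rplus_nd|exact: Rminus_nd]. Qed.

Let Rminus_le_Rpm x : Rminus nu x <= Rpm x.
Proof. by case: RpmE => -> //; exact: Rminus_le_Rplus. Qed.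

Let Rpm_le_Rplus x : Rpm x <= Rplus nu x.
Proof. by case: RpmE => -> //; exact: Rminus_le_Rplus. Qed.

Let Rpm_lt z : z < q -> Rpm z < s.
Proof. by move=> /(Rplus_lt_quantile s01); exact: le_lt_trans. Qed.

Let Rpm_gt z : q < z -> s < Rpm z.
Proof. by move=> /(Rminus_gt_quantile s01 sc)/lt_le_trans; exact. Qed.

Let Rminus_q : Rminus nu q <= s.
Proof. exact: Rminus_quantile. Qed.

Let Rplus_q : s <= Rplus nu q.
Proof. exact: (quantile_min nu s01).1. Qed.

Let time := arrival Rpm s a.

(** The integrands differ by the sign of s - Rpm, which the orientation of the
    integral undoes, and possibly at the single point q. *)
Lemma Phi_arrival x : Phi_dom nu mu0 s x -> Phi mu0 Rpm s x = time x.
Proof.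
have closed_open (u v : R) :
    (\int[lebesgue_measure]_(z in `[u, v]) ((s - Rpm z)^-1)%:E =
     \int[lebesgue_measure]_(z in `]u, v[) ((s - Rpm z)^-1)%:E)%E.
  rewrite (@integral_itv_bndoo _ _ _ _ true false)//.
  by apply/measurable_EFinP; exact: measurable_inv_speed.
rewrite /Phi_dom/= in_itv/= -/a -/q /time /arrival /Phi /oriented_integral -/a.
have [aq|qa] := leP a q => /andP[ax xq].
  rewrite ax (min_l ax) (max_r ax) (travel_oo s Rpm_nd).
  rewrite closed_open.
  apply: eq_integral => z; rewrite inE/= in_itv/= => /andP[_ zx].
  by rewrite gtr0_norm// subr_gt0 Rpm_lt// (lt_le_trans zx).
rewrite (min_r xq) (max_l xq) (travel_oo s Rpm_nd).
have [ax'|xa] := leP a x.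
  have -> : x = a by apply/le_anti; rewrite xq.
  by rewrite closed_open set_itv_ge ?integral_set0// bnd_simp ltxx.
rewrite closed_open.
rewrite -[RHS]oppeK -[in RHS]integral_ge0N; last first.
  by move=> z _; rewrite lee_fin invr_ge0.
congr (- _)%E; apply: eq_integral => z; rewrite inE/= in_itv/= => /andP[xz _].
by rewrite ltr0_norm ?invrN ?EFinN ?oppeK// subr_lt0 Rpm_gt// (le_lt_trans ax).
Qed.

Let q_dom : Phi_dom nu mu0 s q.
Proof. by rewrite /Phi_dom/= in_itv/= ge_min le_max -/q !lexx !orbT. Qed.

Let a_dom : Phi_dom nu mu0 s a.
Proof. by rewrite /Phi_dom/= in_itv/= ge_min le_max -/a !lexx. Qed.

Let time_q_ge0 : (0 <= time q)%E.
Proof. exact: travel_ge0. Qed.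

Let before_stop t : (t%:E < stop_time nu mu0 Rpm s)%E = ((2 * t)%:E < time q)%E.
Proof.
rewrite /stop_time Phi_arrival//; move: time_q_ge0.
case: (time q) => [r _|_|//].
  by rewrite -EFinM !lte_fin; apply/idP/idP; lra.
by rewrite gt0_muley ?lte_fin ?invr_gt0// !ltry.
Qed.

Lemma curve_before t : 0 <= t -> ((2 * t)%:E < time q)%E ->
  Phi_dom nu mu0 s (g t) /\ time (g t) = (2 * t)%:E.
Proof.
move=> t0 tq; rewrite /g /solution_curve before_stop tq.
have : (Phi mu0 Rpm s @` Phi_dom nu mu0 s) (2 * t)%:E.
  have t20 : 0 <= 2 * t by rewrite mulr_ge0.
  have [x Dx xt] := arrival_surj Rpm_nd Rpm_lt Rpm_gt t20 tq.
  have xdom : Phi_dom nu mu0 s x by [].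
  by exists x; rewrite // Phi_arrival.
set p := 'pinv_ _ _ _ => img.
have pdom : Phi_dom nu mu0 s (p (2 * t)%:E).
  apply: (@surjpinv_image_sub _ _ (fun=> q) _ _ (Phi mu0 Rpm s) (fun _ => id)).
  by exists (2 * t)%:E.
by split=> //; rewrite -Phi_arrival// pinvK// inE.
Qed.

Lemma curve_after t : (time q <= (2 * t)%:E)%E -> g t = q.
Proof. by move=> tq; rewrite /g /solution_curve before_stop ltNge tq. Qed.

Let increment x y r d : Phi_dom nu mu0 s x -> Phi_dom nu mu0 s y -> 0 <= d ->
  time x = r%:E -> time y = (r + d)%:E ->
  d * (s - Rplus nu (Num.max x y)) <= y - x <=
  d * (s - Rminus nu (Num.min x y)).
Proof.
move=> Dx Dy d0 xr yr.
have /andP[l u] := arrival_increment Rpm_nd Rpm_lt Rpm_gt Dx Dy d0 xr yr.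
have ? := Rpm_le_Rplus (Num.max x y).
have ? := Rminus_le_Rpm (Num.min x y).
by apply/andP; split; nra.
Qed.

(** The initial position a and g 0 have the same arrival time 0, so they
    coincide; if already the time to reach q is 0, the same argument gives
    a = q. *)
Lemma curve0 : g 0 = a.
Proof.
have t0 : time a = 0%:E by rewrite /time /arrival minxx maxxx travelxx.
have [tq|tq] := ltP (0%:E) (time q).
  have [gD gt] : Phi_dom nu mu0 s (g 0) /\ time (g 0) = (2 * 0)%:E.
    by apply: curve_before; rewrite ?mulr0.
  rewrite mulr0 in gt.
  have := increment a_dom gD (lexx 0) t0.
  by rewrite addr0 => /(_ gt); rewrite !mul0r; lra.
have tq0 : time q = 0%:E by apply/le_anti; rewrite tq time_q_ge0.
rewrite curve_after ?mulr0//.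
have := increment a_dom q_dom (lexx 0) t0.
by rewrite addr0 => /(_ tq0); rewrite !mul0r; lra.
Qed.

(** While the particle moves this is [arrival_increment] with d = 2 (t2 - t1).
    A particle at rest at q is covered because s lies between Rminus q and
    Rplus q. If q is reached in between, the bounds for the moving part extend
    to the longer duration, since the velocity bounds have the right sign. *)
Lemma curve_slope_bounds : slope_bounds nu s g.
Proof.
move=> t1 t2 t10 t12; have t20 : 0 <= t2 by exact: le_trans (ltW t12).
have [qt1|t1q] := leP (time q) (2 * t1)%:E.
  have qt2 : (time q <= (2 * t2)%:E)%E.
    by apply: le_trans qt1 _; rewrite lee_fin; lra.
  rewrite !curve_after// maxxx minxx subrr.
  have d0 : 0 <= 2 * (t2 - t1) by lra.
  by rewrite mulr_ge0_le0 ?subr_le0//= mulr_ge0 ?subr_ge0.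
have [D1 g1] := curve_before t10 t1q.
have [qt2|t2q] := leP (time q) (2 * t2)%:E; last first.
  have [D2 g2] := curve_before t20 t2q.
  apply: increment D1 D2 _ g1 _; first lra.
  by rewrite g2; congr (_%:E); lra.
rewrite (curve_after qt2).
have [T tq] : exists T : R, time q = T%:E.
  exists (fine (time q)); rewrite fineK// ge0_fin_numE//.
  exact: le_lt_trans qt2 (ltry _).
move: qt2 t1q; rewrite tq lee_fin lte_fin => Tt2 Tt1.
have d0 : 0 <= T - 2 * t1 by lra.
have : time q = (2 * t1 + (T - 2 * t1))%:E by rewrite tq; congr (_%:E); lra.
move=> /(increment D1 q_dom d0 g1).
have [gq|qg] := leP (g t1) q; move=> /andP[l u]; apply/andP; split.
- apply: (@le_trans _ _ 0); last by rewrite subr_ge0.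
  by rewrite mulr_ge0_le0 ?subr_le0//; lra.
- apply: le_trans u _; apply: ler_wpM2r; last lra.
  by rewrite subr_ge0 (le_trans _ Rminus_q)// Rminus_nd.
- apply: le_trans _ l; apply: ler_wnM2r; last lra.
  by rewrite subr_le0 (le_trans Rplus_q)// Rplus_nd// ltW.
- apply: (@le_trans _ _ 0); first by rewrite subr_le0 ltW.
  by rewrite mulr_ge0 ?subr_ge0//; lra.
Qed.

(** The position determines the arrival time, so a moving particle cannot occupy
    a position twice. *)
Lemma curve_stops : stops_when_repeating g.
Proof.
move=> t1 t2 t t10 t12 g12 t1t; have t20 : 0 <= t2 by exact: le_trans (ltW t12).
suff qt1 : (time q <= (2 * t1)%:E)%E.
  rewrite !curve_after// (le_trans qt1)// lee_fin; lra.
rewrite leNgt; apply/negP => t1q; have [_ g1] := curve_before t10 t1q.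
have [qt2|t2q] := leP (time q) (2 * t2)%:E.
  by move: t1q; rewrite -g1 g12 curve_after// ltxx.
have [_ ] := curve_before t20 t2q.
by rewrite -g12 g1 => -[]; lra.
Qed.

End the_solution_curve.

Theorem lemma5p1 (R : realType) (nu mu0 : probability (measurableTypeR R) R)
  (nu2 : finite_second_moment nu) (mu02 : finite_second_moment mu0)
  (Rpm : R -> R) (RpmE : Rpm = Rplus nu \/ Rpm = Rminus nu)
  (s : R) (s01 : 0 < s < 1) (sc : {for s, continuous (quantile nu)}) :
  let g := solution_curve nu mu0 Rpm s in
  strong_solution (rhs nu s) (quantile mu0 s) g /\
  (forall t : R, 0 < t -> derivable g t 1 -> rhs nu s (g t) (derive1 g t)).
Proof.
move=> g; have slopes := curve_slope_bounds mu0 RpmE s01 sc.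
split; last by move=> t; exact: derive_in_rhs.
apply: (strong_solution_of_slope_bounds s01 slopes).
  exact: (curve_stops RpmE s01 sc).
exact: (curve0 mu0 RpmE s01 sc).
Qed.
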